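(* Let $\alpha>0$, $\beta>0$, $t\ge0$. For every integer $n\ge0$, $$r^*_{n+1}+r^*_n=t-\alpha_nR^*_n,$$ $$R^*_n-R_n=-2n-1-\alpha-\beta,$$ $$r_{n+1}+r_n=(1-\alpha_n)R_n-\beta,$$ where $\alpha_n$ is the diagonal recurrence coefficient and $R_n,R_n^*,r_n,r_n^*$ are the auxiliary quantities associated with the weight $w(x)=e^{-t/x}x^\alpha(1-x)^\beta$ on $[0,1]$, as defined in the context.
   Context: $w(x)=w(x;t)=e^{-t/x}x^\alpha(1-x)^\beta$ on $[0,1]$. $P_n$ is the monic polynomial of degree $n$ with $\int_0^1P_mP_nw\,dx=h_n\delta_{m,n}$. The recurrence coefficients $\alpha_n,\beta_n$ (not to be confused with the parameters $\alpha,\beta$) are defined by $xP_n(x)=P_{n+1}(x)+\alpha_nP_n(x)+\beta_nP_{n-1}(x)$, with $P_0=1$, $\beta_0P_{-1}=0$. Auxiliary quantities: $R_n^*:=\frac{t}{h_n}\int_0^1[P_n(y)]^2w(y)\frac{dy}{y}$, $R_n:=\frac{\beta}{h_n}\int_0^1[P_n(y)]^2w(y)\frac{dy}{1-y}$, $r_n^*:=\frac{t}{h_{n-1}}\int_0^1P_{n-1}(y)P_n(y)w(y)\frac{dy}{y}$, $r_n:=\frac{\beta}{h_{n-1}}\int_0^1P_{n-1}(y)P_n(y)w(y)\frac{dy}{1-y}$, with $r_0=r_0^*:=0$. All these quantities depend on $t$. *)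

(* Defs.v *)
From HB Require Import structures.
From mathcomp Require Import all_boot all_order all_algebra.
From mathcomp Require Import all_classical all_reals all_analysis.

Set Implicit Arguments.
Unset Strict Implicit.
Unset Printing Implicit Defensive.

Import Order.TTheory GRing.Theory Num.Theory.
Import numFieldNormedType.Exports.

Local Open Scope classical_set_scope.
Local Open Scope ring_scope.

(* At x = 0 the convention t / 0 = 0 and 0 `^ alpha = 0 (for alpha != 0) give
   the value 0; the values of all the integrands below at the end points 0
   and 1 are irrelevant, {0, 1} being Lebesgue-negligible. *)
Definition weight (R : realType) (alpha beta t x : R) : R :=
  expR (- (t / x)) * x `^ alpha * (1 - x) `^ beta.

Definition monic_orthogonal (R : realType) (w : R -> R)
    (P : nat -> {poly R}) (h : nat -> R) : Prop :=
  (forall n, P n \is monic /\ size (P n) = n.+1) /\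
  (forall m n, \int[lebesgue_measure]_(x in `[0, 1])
                 ((P m).[x] * (P n).[x] * w x)
               = if m == n then h n else 0).

(* The term b_0 P_{-1} is read as 0, hence b 0 is unconstrained. *)
Definition recurrence_coefficients (R : realType)
    (P : nat -> {poly R}) (a b : nat -> R) : Prop :=
  forall n, 'X * P n = P n.+1 + a n *: P n
                       + (if n is m.+1 then b m.+1 *: P m else 0).

Definition aux_Rstar (R : realType) (t : R) (w : R -> R)
    (P : nat -> {poly R}) (h : nat -> R) (n : nat) : R :=
  t / h n * \int[lebesgue_measure]_(y in `[0, 1])
              ((P n).[y] ^+ 2 * w y / y).

Definition aux_R (R : realType) (beta : R) (w : R -> R)
    (P : nat -> {poly R}) (h : nat -> R) (n : nat) : R :=
  beta / h n * \int[lebesgue_measure]_(y in `[0, 1])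
                 ((P n).[y] ^+ 2 * w y / (1 - y)).

Definition aux_rstar (R : realType) (t : R) (w : R -> R)
    (P : nat -> {poly R}) (h : nat -> R) (n : nat) : R :=
  if n is m.+1 then
    t / h m * \int[lebesgue_measure]_(y in `[0, 1])
                ((P m).[y] * (P m.+1).[y] * w y / y)
  else 0.

Definition aux_r (R : realType) (beta : R) (w : R -> R)
    (P : nat -> {poly R}) (h : nat -> R) (n : nat) : R :=
  if n is m.+1 then
    beta / h m * \int[lebesgue_measure]_(y in `[0, 1])
                   ((P m).[y] * (P m.+1).[y] * w y / (1 - y))
  else 0.

(* Main.v *)
Require Import Defs.
From HB Require Import structures.
From mathcomp Require Import all_boot all_order all_algebra.
From mathcomp Require Import all_classical all_reals all_analysis.
From mathcomp Require Import measurable_realfun.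
From mathcomp Require Import ring lra.

Import Order.TTheory GRing.Theory Num.Theory.
Import numFieldNormedType.Exports.

Local Open Scope ring_scope.

(* Multiplying the recurrence by P_n w / y and by P_n w / (1 - y) and
   integrating gives the first and third identities, because
   y / (1 - y) = 1 / (1 - y) - 1 and b_n = h_n / h_{n-1}. The second one is the
   integral over [0, 1] of
     (y P_n^2 w)' = (y P_n^2)' w + (t / y + alpha + beta - beta / (1 - y)) P_n^2 w,
   whose left-hand side integrates to 0; moreover y P_n' - n P_n has degree
   less than n, so (y P_n^2)' w integrates to (2n + 1) h_n. The derivative may
   be unbounded at the end points (when alpha < 1 or beta < 1), hence the need
   for a fundamental theorem of calculus on open intervals. *)

(** * Fundamental theorem of calculus on an open interval, by exhaustion with compact
    subintervals *)

Section improper_FTC.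
Local Open Scope classical_set_scope.
Local Open Scope ring_scope.
Context {R : realType} (a b : R) (F f : R -> R).
Hypothesis ab : a < b.
Hypothesis dF : forall x : R, x \in `]a, b[ -> is_derive x 1 F (f x).
Hypothesis Fa : F x @[x --> a^'+] --> F a.
Hypothesis Fb : F x @[x --> b^'-] --> F b.
Hypothesis cf : {in `]a, b[, continuous f}.

Local Notation mu := (@lebesgue_measure R).
(** With the denominator [n.+3], twice the margin [d n] is smaller than [b - a] already for [n = 0],
    so every [J n] is a nondegenerate compact interval inside []a, b[]. *)
Let d n : R := (b - a) / n.+3%:R.
Let J n : set R := `[a + d n, b - d n].

Let d_gt0 n : 0 < d n.
Proof. by rewrite divr_gt0// subr_gt0. Qed.

Let d_lt n : a + d n < b - d n.
Proof.
rewrite -subr_gt0 (_ : _ - _ = (b - a) * (1 - 2 / n.+3%:R)); last first.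
  by rewrite /d; ring.
rewrite mulr_gt0 ?subr_gt0// ltr_pdivrMr ?ltr0n// mul1r ltr_nat.
by [].
Qed.

Let d_cvg : d n @[n --> \oo] --> 0.
Proof.
rewrite -(mulr0 (b - a)); apply: cvgMl_tmp.
by have := @cvg_harmonic R; rewrite -(cvg_shiftn 2); under eq_fun do rewrite addn2.
Qed.

Let J_sub n : J n `<=` `]a, b[.
Proof.
move=> x; rewrite /J/= !in_itv/= => /andP[ax xb].
have := d_gt0 n; lra.
Qed.

Let J_nd : nondecreasing_seq J.
Proof.
move=> m n mn; rewrite subsetEset => x; rewrite /J/= !in_itv/=.
have : d n <= d m.
  by rewrite /d ler_pM2l ?subr_gt0// lef_pV2 ?posrE ?ltr0n// ler_nat !ltnS.
lra.
Qed.

Let J_cup : \bigcup_n J n = `]a, b[%classic.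
Proof.
apply/seteqP; split => [x [n _]|x]; first exact: J_sub.
rewrite /= in_itv/= => /andP[ax xb].
have e0 : 0 < Order.min (x - a) (b - x) by rewrite lt_min !subr_gt0 ax.
have /cvgrPdist_lt/(_ _ e0)[N _ /(_ N (leqnn _))/=] := d_cvg.
rewrite sub0r normrN gtr0_norm// lt_min => /andP[? ?].
by exists N => //; rewrite /J/= in_itv/=; apply/andP; split; lra.
Qed.

Let int_J n : (\int[mu]_(x in J n) (f x)%:E)%E = (F (b - d n) - F (a + d n))%:E.
Proof.
have JS (x : R) : x \in `]a + d n, b - d n[ -> x \in `]a, b[.
  by rewrite !in_itv/= => xJ; have := d_gt0 n; lra.
have JS' (x : R) : x \in `[a + d n, b - d n] -> x \in `]a, b[ by exact: J_sub.
rewrite (@continuous_FTC2 _ f F) ?d_lt//.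
- by apply: continuous_in_subspaceT => x /set_mem/JS'; exact: cf.
- have cF x : x \in `]a, b[ -> {for x, continuous F}.
    by move=> /dF/@ex_derive/derivable1_diffP/differentiable_continuous.
  split => [x /JS/dF/@ex_derive//||].
  + by apply/cvg_at_right_filter/cF/JS'; rewrite in_itv/= lexx ltW ?d_lt.
  + by apply/cvg_at_left_filter/cF/JS'; rewrite in_itv/= lexx ltW ?d_lt.
- by move=> x /JS/dF ?; rewrite derive1E derive_val.
Qed.

Let int_J_cvg : (\int[mu]_(x in J n) (f x)%:E)%E @[n --> \oo] --> (F b - F a)%:E.
Proof.
under eq_fun do rewrite int_J.
apply: cvg_EFin; first by near=> n.
apply: cvgB.
  move/cvg_at_leftP : Fb; apply; split => [n|]; first by have := d_gt0 n; lra.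
  by rewrite -[X in _ --> X]subr0; apply: cvgB => //; exact: cvg_cst.
move/cvg_at_rightP : Fa; apply; split => [n|]; first by have := d_gt0 n; lra.
by rewrite -[X in _ --> X]addr0; apply: cvgD => //; exact: cvg_cst.
Unshelve. all: by end_near. Qed.

Let mf : measurable_fun `]a, b[%classic f.
Proof.
apply: open_continuous_measurable_fun; first exact: interval_open.
by move=> x /set_mem; exact: cf.
Qed.

(** Monotone convergence along [J n]: for a nonnegative [f] the integral over the open interval is
    the limit of [F (b - d n) - F (a + d n)], that is, the finite number [F b - F a]. *)
Lemma ge0_improper_integrable :
  (forall x, a < x < b -> 0 <= f x) -> mu.-integrable `[a, b] (EFin \o f).
Proof.
move=> f0; apply/integrableP; split.
  by apply/measurable_EFinP/measurable_fun_itv_obnd_cbndP/measurable_fun_itv_bndo_bndcP.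
rewrite integral_itv_bndoo; last by apply/measurableT_comp => //; exact/measurable_EFinP.
under eq_integral => x /set_mem/= xab.
  rewrite ger0_norm; last by apply: f0; rewrite in_itv/= in xab.
  over.
have : (\int[mu]_(x in J n) (f x)%:E)%E @[n --> \oo] --> (\int[mu]_(x in `]a, b[) (f x)%:E)%E.
  rewrite -J_cup; apply: ge0_nondecreasing_set_cvg_integral => //.
  - by move=> n; exact: measurable_itv.
  - by move=> n; apply/measurable_EFinP; exact: measurable_funS (@J_sub n) mf.
  - by move=> n x /J_sub/=; rewrite in_itv/= lee_fin; exact: f0.
move=> /(cvg_unique _ int_J_cvg) <-//.
by rewrite ltry.
Qed.

(** Here [f] may change sign. Once it is integrable, its absolute value dominates all its
    restrictions to [J n], and dominated convergence replaces monotone convergence. *)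
Lemma integrable_improper_FTC2 :
  mu.-integrable `[a, b] (EFin \o f) ->
  \int[mu]_(x in `[a, b]) f x = F b - F a.
Proof.
move=> intf.
rewrite /Rintegral integral_itv_bndoo; last exact/measurable_EFinP.
apply: EFin_inj; rewrite fineK; last first.
  apply: integrable_fin_num => //.
  by apply: integrableS intf => //; exact: subset_itv_oo_cc.
have mJ n : measurable_fun `]a, b[%classic ((EFin \o f) \_ (J n)).
  apply/measurable_restrict => //; first exact: measurable_itv.
  apply/measurable_EFinP; apply: measurable_funS mf => //; exact: subIsetl.
have abs_int : mu.-integrable `]a, b[%classic (abse \o (EFin \o f)).
  by apply: integrable_abse; apply: integrableS intf => //; exact: subset_itv_oo_cc.
have mEf : measurable_fun `]a, b[%classic (EFin \o f) by exact/measurable_EFinP.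
have [||_ _] := @dominated_convergence _ _ _ mu `]a, b[%classic
  (measurable_itv `]a, b[) _ _ _ mJ mEf _ abs_int _.
- apply: aeW => x xab.
  (* The restrictions are eventually equal to [f x] at [x], because [x] lies in all [J n] from some
     rank on. *)
  apply: cvg_near_cst.
  have [N _ JNx] : (\bigcup_n J n) x by rewrite J_cup.
  near=> n; rewrite patchE ifT//; apply/mem_set.
  have /J_nd : (N <= n)%N by near: n; exact: nbhs_infty_ge.
  by rewrite subsetEset; exact.
- apply: aeW => x n xab; rewrite patchE; case: ifPn => // _.
  by rewrite abse0 abse_ge0.
under eq_cvg => n.
  rewrite /= -integral_mkcondr (setIidr (@J_sub n)).
  over.
by move/cvg_unique; apply => //; exact: int_J_cvg.
Unshelve. all: by end_near. Qed.
End improper_FTC.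

Lemma is_derive_continuous {R : realType} (f : R -> R) (x df : R) :
  is_derive x 1 f df -> {for x, continuous f}.
Proof. by move=> /@ex_derive/derivable1_diffP/differentiable_continuous. Qed.

(** * Powers of x and of 1 - x near the end points of [0, 1] *)

Section powR_derive.
Context {R : realType}.
Implicit Types (p x : R).

Lemma is_derive_powR_onem p x : x < 1 ->
  is_derive x 1 (fun y : R => (1 - y) `^ p) (- (p * (1 - x) `^ (p - 1))).
Proof.
move=> x1; have x1' : 0 < 1 - x by rewrite subr_gt0.
have d1 : is_derive x 1 (fun y : R => 1 - y) (-1).
  by apply: is_derive_eq; ring.
have := @is_derive1_comp R (@powR R ^~ p) (fun y => 1 - y) x _ _ (is_derive1_powR p x1') d1.
by rewrite mulrN1.
Qed.

Lemma powR_onem_cvg0 p : 0 < p -> ((1 - x) `^ p @[x --> (1:R)^'-] --> 0)%classic.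
Proof.
move=> p0; apply/cvg_at_leftP => u [u1 ucvg].
have /cvg_at_rightP : (x `^ p @[x --> (0:R)^'+] --> 0)%classic by exact: powR_cvg0.
apply; split => [n|]; first by rewrite subr_gt0.
by rewrite -(subrr 1); apply: cvgB => //; exact: cvg_cst.
Qed.

(** For [p < 1] the integrand blows up at 0, but its primitive x^p / p still has the limit 0 there.
    These powers will dominate w(x) / x. *)
Lemma integrable_powR01 p : 0 < p ->
  lebesgue_measure.-integrable `[0, 1]%classic (EFin \o (fun x : R => x `^ (p - 1))).
Proof.
move=> p0; have p0' : p != 0 by rewrite gt_eqF.
have dF (x : R) : 0 < x -> is_derive x 1 (fun y => p^-1 * y `^ p) (x `^ (p - 1)).
  move=> x0; have ? := is_derive1_powR p x0.
  by apply: is_derive_eq; rewrite scalerA mulVf// scale1r.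
apply: (@ge0_improper_integrable R 0 1 (fun y => p^-1 * y `^ p) _ ltr01).
- by move=> x; rewrite in_itv/= => /andP[x0 _]; exact: dF.
- rewrite powR0// mulr0 -[X in (_ --> X)%classic](mulr0 p^-1).
  by apply: cvgMl_tmp; exact: powR_cvg0.
- by apply: cvg_at_left_filter; exact: is_derive_continuous (dF 1 ltr01).
- move=> x; rewrite in_itv/= => /andP[x0 _].
  exact: is_derive_continuous (is_derive1_powR _ x0).
- by move=> x _; exact: powR_ge0.
Qed.

Lemma integrable_powR_onem01 p : 0 < p ->
  lebesgue_measure.-integrable `[0, 1]%classic (EFin \o (fun x : R => (1 - x) `^ (p - 1))).
Proof.
move=> p0; have p0' : p != 0 by rewrite gt_eqF.
have dF (x : R) : x < 1 ->
    is_derive x 1 (fun y => - p^-1 * (1 - y) `^ p) ((1 - x) `^ (p - 1)).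
  move=> x0; have ? := is_derive_powR_onem p _ x0.
  by apply: is_derive_eq; rewrite scalerN scaleNr opprK scalerA mulVf// scale1r.
apply: (@ge0_improper_integrable R 0 1 (fun y => - p^-1 * (1 - y) `^ p) _ ltr01).
- by move=> x; rewrite in_itv/= => /andP[_ x0]; exact: dF.
- by apply: cvg_at_right_filter; exact: is_derive_continuous (dF 0 ltr01).
- rewrite subrr powR0// mulr0 -[X in (_ --> X)%classic](mulr0 (- p^-1)).
  by apply: cvgMl_tmp; exact: powR_onem_cvg0.
- move=> x; rewrite in_itv/= => /andP[_ x0].
  exact: is_derive_continuous (is_derive_powR_onem _ _ x0).
- by move=> x _; exact: powR_ge0.
Qed.

End powR_derive.

(** An infinite root set would contain [size p] distinct roots, more than the degree allows. This
    lets the roots be discarded as a null set. *)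
Lemma finite_set_roots {R : realType} (p : {poly R}) :
  p != 0 -> finite_set [set x | root p x]%classic.
Proof.
move=> p0; apply: contrapT => /(@infinite_set_fset _ _ (size p))[X XR pX].
have rX : all (root p) (finmap.enum_fset X) by apply/allP => x xX; exact: XR.
by rewrite leqNgt (max_poly_roots p0 rX (finmap.fset_uniq X)) in pX.
Qed.

(** * Integrals over [0, 1] of a polynomial times a fixed integrable function *)

Section polynomial_moments.
Context {R : realType}.
Local Notation mu := (@lebesgue_measure R).
Implicit Types (g : R -> R) (p q : {poly R}).

(** The factor [g] is a parameter because the same linear functional is used for w(x), w(x) / x and
    w(x) / (1 - x). *)
Definition polyint g p : R := \int[mu]_(x in `[0, 1]) (p.[x] * g x).

(** A polynomial is bounded on the compact interval [0, 1]. *)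
Lemma integrable_horner g p : mu.-integrable `[0, 1]%classic (EFin \o g) ->
  mu.-integrable `[0, 1]%classic (EFin \o (fun x => p.[x] * g x)).
Proof.
move=> ig.
have cp : {within `[0, 1], continuous (horner p)}%classic.
  exact/continuous_subspaceT/continuous_horner.
have := @integrableMr _ _ _ mu `[0, 1]%classic (measurable_itv _) (horner p) (EFin \o g).
apply => //.
  by apply: measurable_funTS; apply: continuous_measurable_fun; exact: continuous_horner.
have /compact_bounded : compact (horner p @` `[0, 1])%classic.
  by apply: continuous_compact => //; exact: segment_compact.
move=> [M [Mr hM]]; exists M; split => // N /hM {}hM x x01 /=.
by apply: hM; exists x.
Qed.

Context (g : R -> R) (ig : mu.-integrable `[0, 1]%classic (EFin \o g)).

Lemma polyintD p q : polyint g (p + q) = polyint g p + polyint g q.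
Proof.
rewrite /polyint -RintegralD//; [|exact: integrable_horner..].
by apply: eq_Rintegral => x _; rewrite hornerD mulrDl.
Qed.

Lemma polyintZ c p : polyint g (c *: p) = c * polyint g p.
Proof.
rewrite /polyint -RintegralZl//; last exact: integrable_horner.
by apply: eq_Rintegral => x _; rewrite hornerZ mulrA.
Qed.

Lemma polyint0 : polyint g 0 = 0.
Proof. by rewrite -(scale0r 0) polyintZ mul0r. Qed.

Lemma polyintB p q : polyint g (p - q) = polyint g p - polyint g q.
Proof. by rewrite polyintD -scaleN1r polyintZ mulN1r. Qed.

End polynomial_moments.

(** * The weight: derivative, behaviour at the end points, integrability and integration by parts *)

Section weight.
Context {R : realType} {alpha beta t : R}.
Hypotheses (halpha : 0 < alpha) (hbeta : 0 < beta) (ht : 0 <= t).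
Local Notation mu := (@lebesgue_measure R).
Local Notation w := (weight alpha beta t).

Lemma weight0 : w 0 = 0.
Proof. by rewrite /weight powR0 ?gt_eqF// mulr0 mul0r. Qed.

Lemma weight1 : w 1 = 0.
Proof. by rewrite /weight subrr powR0 ?gt_eqF// mulr0. Qed.

Lemma weight_ge0 (x : R) : 0 <= w x.
Proof. by rewrite !mulr_ge0 ?expR_ge0 ?powR_ge0. Qed.

Lemma weight_gt0 (x : R) : 0 < x < 1 -> 0 < w x.
Proof.
by move=> /andP[x0 x1]; rewrite !mulr_gt0 ?expR_gt0 ?powR_gt0 ?subr_gt0.
Qed.

Let powR_le1 (x p : R) : 0 <= x <= 1 -> 0 < p -> x `^ p <= 1.
Proof.
move=> /andP[x0 x1] p0; rewrite -[leRHS](congr1 (@^~ p) (powR1 R)).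
by rewrite ge0_ler_powR ?nnegrE// ltW.
Qed.

Let expR_le1 (x : R) : 0 <= x -> expR (- (t / x)) <= 1.
Proof. by move=> x0; rewrite -expR0 ler_expR oppr_le0 divr_ge0. Qed.

(** The two dropped factors are at most 1. The factor kept controls [w] at 0: it gives both the
    limit 0 there and the bound of w(x) / x by x^(alpha - 1). *)
Lemma weight_le_powR (x : R) : 0 <= x <= 1 -> w x <= x `^ alpha.
Proof.
move=> x01; rewrite /weight -mulrA -[leRHS]mul1r ler_pM ?mulr_ge0 ?powR_ge0 ?expR_ge0//.
  by rewrite expR_le1//; lra.
by rewrite ler_piMr ?powR_ge0// powR_le1//; lra.
Qed.

Lemma weight_le_powR_onem (x : R) : 0 <= x <= 1 -> w x <= (1 - x) `^ beta.
Proof.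
move=> x01; rewrite /weight -[leRHS]mul1r ler_wpM2r ?powR_ge0//.
by rewrite mulr_ile1 ?expR_ge0 ?powR_ge0 ?expR_le1 ?powR_le1//; lra.
Qed.

Lemma is_derive_weight (x : R) : 0 < x < 1 ->
  is_derive x 1 w (w x * (t / x ^+ 2 + alpha / x - beta / (1 - x))).
Proof.
move=> /andP[x0 x1].
have x1' : 0 < 1 - x by rewrite subr_gt0.
have xn0 : x != 0 by rewrite gt_eqF.
have d1 : is_derive x 1 (fun y => - (t / y)) (t / x ^+ 2).
  have := @is_deriveV R id x 1 1 xn0 (is_derive_id _ _) => d.
  by apply: is_derive_eq; rewrite scaleNr scalerN opprK /GRing.scale/= mulr1.
have d2 := @is_derive1_comp R expR (fun y => - (t / y)) x _ _ (is_derive_expR _) d1.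
have d3 := is_derive1_powR alpha x0.
have d4 := is_derive_powR_onem beta _ x1.
have := is_deriveM (is_deriveM d2 d3) d4.
move=> d; apply: (is_derive_eq d).
rewrite /weight /GRing.scale/= !fctE /=.
(* Splitting one factor x off x^alpha, and one factor 1 - x off (1 - x)^beta, leaves an identity of
   rational functions. *)
rewrite -(mulr_powRB1 (ltW x0) halpha) -(mulr_powRB1 (ltW x1') hbeta).
by field; rewrite xn0 gt_eqF.
Qed.

Lemma continuous_weight (x : R) : 0 < x < 1 -> {for x, continuous w}.
Proof. by move=> x01; exact: is_derive_continuous (is_derive_weight _ x01). Qed.

Lemma weight_cvg0 : (w x @[x --> (0:R)^'+] --> 0)%classic.
Proof.
apply: (@squeeze_cvgr _ _ _ _ (cst 0) (@powR R ^~ alpha)).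
- near=> x; rewrite weight_ge0/= weight_le_powR//.
  by apply/andP; split; near: x; [exact: nbhs_right_ge|exact: nbhs_right_le].
- exact: cvg_cst.
- exact: powR_cvg0.
Unshelve. all: by end_near. Qed.

Lemma weight_cvg1 : (w x @[x --> (1:R)^'-] --> 0)%classic.
Proof.
apply: (@squeeze_cvgr _ _ _ _ (cst 0) (fun x => (1 - x) `^ beta)).
- near=> x; rewrite weight_ge0/= weight_le_powR_onem//.
  by apply/andP; split; near: x; [exact: nbhs_left_ge|exact: nbhs_left_le].
- exact: cvg_cst.
- exact: powR_onem_cvg0.
Unshelve. all: by end_near. Qed.

(** Continuity inside gives measurability on the closed interval, as adding the two end points does
    not affect it; the rest is domination. *)
Let integrable_bounded01 (g k : R -> R) :
  (forall x, 0 < x < 1 -> {for x, continuous g}) ->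
  mu.-integrable `[0, 1]%classic (EFin \o k) ->
  (forall x, 0 <= x <= 1 -> 0 <= g x <= k x) ->
  mu.-integrable `[0, 1]%classic (EFin \o g).
Proof.
move=> cg ik gk; apply: le_integrable ik => //.
  apply/measurable_EFinP/measurable_fun_itv_obnd_cbndP/measurable_fun_itv_bndo_bndcP.
  apply: open_continuous_measurable_fun; first exact: interval_open.
  by move=> x /set_mem/=; rewrite in_itv/=; exact: cg.
move=> x /=; rewrite in_itv/= => /gk/andP[g0 gk'].
by rewrite lee_fin !ger0_norm// (le_trans g0).
Qed.

Lemma integrable_weight_div : mu.-integrable `[0, 1]%classic (EFin \o (fun x => w x / x)).
Proof.
apply: integrable_bounded01 (integrable_powR01 _ halpha) _ => [x x01|x x01].
  apply: cvgM; first exact: continuous_weight.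
  by apply: inv_continuous; lra.
rewrite divr_ge0 ?weight_ge0//=; last lra.
have [->|xn0] := eqVneq x 0; first by rewrite weight0 mul0r powR_ge0.
have x0 : 0 < x by rewrite lt_def xn0/=; lra.
by rewrite ler_pdivrMr// mulrC mulr_powRB1// ?weight_le_powR// ltW.
Qed.

Lemma integrable_weight_div_onem :
  mu.-integrable `[0, 1]%classic (EFin \o (fun x => w x / (1 - x))).
Proof.
apply: integrable_bounded01 (integrable_powR_onem01 _ hbeta) _ => [x x01|x x01].
  apply: cvgM; first exact: continuous_weight.
  apply: (@cvgV _ _ _ _ (fun x => 1 - x)); first lra.
  by apply: cvgB; [exact: cvg_cst|exact: cvg_id].
rewrite divr_ge0 ?weight_ge0//=; last lra.
have [->|xn0] := eqVneq x 1; first by rewrite weight1 mul0r powR_ge0.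
have x0 : 0 < 1 - x by rewrite subr_gt0 lt_def eq_sym xn0/=; lra.
by rewrite ler_pdivrMr// mulrC mulr_powRB1// ?weight_le_powR_onem// ltW.
Qed.

(** Since [w] vanishes at 0, the cancellation holds there too, so integrands can be compared
    pointwise on all of [0, 1]. *)
Lemma weight_divK (x : R) : x * (w x / x) = w x.
Proof.
have [->|x0] := eqVneq x 0; first by rewrite weight0 mul0r.
by rewrite mulrC divfK.
Qed.

Lemma weight_div_onemK (x : R) : (1 - x) * (w x / (1 - x)) = w x.
Proof.
have [->|x1] := eqVneq x 1; first by rewrite weight1 mul0r mulr0.
by rewrite mulrC divfK// subr_eq0 eq_sym.
Qed.

Lemma integrable_weight : mu.-integrable `[0, 1]%classic (EFin \o w).
Proof.
have -> : w = fun x => ('X : {poly R}).[x] * (w x / x).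
  by apply/funext => x; rewrite hornerX weight_divK.
exact/integrable_horner/integrable_weight_div.
Qed.

Local Notation wx := (fun x => w x / x).
Local Notation wy := (fun x => w x / (1 - x)).

Lemma polyint_weight_div p : polyint wx ('X * p) = polyint w p.
Proof.
by apply: eq_Rintegral => x _; rewrite hornerM hornerX/= mulrAC weight_divK mulrC.
Qed.

Lemma polyint_weight_div_onem p : polyint wy ((1 - 'X) * p) = polyint w p.
Proof.
apply: eq_Rintegral => x _; rewrite hornerM hornerD hornerN hornerX hornerC.
by rewrite mulrAC weight_div_onemK mulrC.
Qed.

(* The integral of (x p w)' over [0, 1]. *)
Lemma polyint_by_parts (p : {poly R}) :
  polyint w (('X * p)^`()) + t * polyint wx p + (alpha + beta) * polyint w p
    - beta * polyint wy p = 0.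
Proof.
have iw := integrable_weight.
have iwx := integrable_weight_div.
have iwy := integrable_weight_div_onem.
pose q := 'X * p.
(* This is (q w)': the logarithmic derivative of [w] turns x p w' into (t / x + alpha - beta x / (1
   - x)) p w, and x / (1 - x) = 1 / (1 - x) - 1. *)
pose f x := (q^`()).[x] * w x + t * (p.[x] * (w x / x))
  + (alpha + beta) * (p.[x] * w x) - beta * (p.[x] * (w x / (1 - x))).
have i1 := integrable_horner _ q^`() iw.
have i2 := integrable_horner _ p iw.
have i3 := integrable_horner _ p iwx.
have i4 := integrable_horner _ p iwy.
have iZ c (g : R -> R) : mu.-integrable `[0, 1]%classic (EFin \o g) ->
    mu.-integrable `[0, 1]%classic (EFin \o (fun x => c * g x)).
  exact: integrableZl.
have iD (g k : R -> R) : mu.-integrable `[0, 1]%classic (EFin \o g) ->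
    mu.-integrable `[0, 1]%classic (EFin \o k) ->
    mu.-integrable `[0, 1]%classic (EFin \o (fun x => g x + k x)).
  exact: integrableD.
have j2 := iZ (alpha + beta) _ i2.
have j3 := iZ t _ i3.
have j4 := iZ beta _ i4.
have j13 := iD _ _ i1 j3.
have j132 := iD _ _ j13 j2.
have i_f : mu.-integrable `[0, 1]%classic (EFin \o f).
  exact: integrableB j132 j4.
transitivity (\int[mu]_(x in `[0, 1]) f x).
  rewrite /polyint -!RintegralZl//.
  by rewrite -RintegralD// -RintegralD// -RintegralB.
have df (x : R) : x \in `]0, 1[ -> is_derive x 1 (fun y => q.[y] * w y) (f x).
  rewrite in_itv/= => x01; have dw := is_derive_weight _ x01.
  have d := is_deriveM (is_derive_poly q x) dw.
  apply: (is_derive_eq d).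
  rewrite /f /q hornerM hornerX /GRing.scale/=; field.
  by move: x01 => /andP[x0 x1]; rewrite !gt_eqF// subr_gt0.
(* The boundary terms vanish because [w] is 0 at both end points and tends to 0 there. *)
rewrite (@integrable_improper_FTC2 R 0 1 (fun y => q.[y] * w y) f ltr01 df) => //.
- by rewrite weight0 weight1 !mulr0 subrr.
- rewrite weight0 mulr0 -[X in (_ --> X)%classic](mulr0 q.[0]); apply: cvgM; last exact: weight_cvg0.
  by apply: cvg_at_right_filter; exact: continuous_horner.
- rewrite weight1 mulr0 -[X in (_ --> X)%classic](mulr0 q.[1]); apply: cvgM; last exact: weight_cvg1.
  by apply: cvg_at_left_filter; exact: continuous_horner.
- move=> x; rewrite in_itv/= => x01.
  have cw := continuous_weight _ x01.
  have cwx : {for x, continuous wx}.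
    by apply: cvgM => //; apply: inv_continuous; lra.
  have cwy : {for x, continuous wy}.
    apply: cvgM => //; apply: (@cvgV _ _ _ _ (fun x => 1 - x)); first lra.
    by apply: cvgB; [exact: cvg_cst|exact: cvg_id].
  have cM (c : R) (g : R -> R) : {for x, continuous g} ->
      {for x, continuous (fun y => c * g y)}.
    by move=> cg; apply: cvgM => //; exact: cvg_cst.
  have cH (r : {poly R}) (g : R -> R) : {for x, continuous g} ->
      {for x, continuous (fun y => r.[y] * g y)}.
    by move=> cg; apply: cvgM => //; exact: continuous_horner.
  exact: (cvgB (cvgD (cvgD (cH _ _ cw) (cM t _ (cH p _ cwx)))
    (cM (alpha + beta) _ (cH p _ cw))) (cM beta _ (cH p _ cwy))).
Qed.

(** A zero integral would make the nonnegative function p^2 w vanish almost everywhere. On []0, 1[]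
    it vanishes only at the finitely many roots of [p], so this interval of measure 1 would be
    negligible. *)
Lemma polyint_weight_sqr_neq0 (p : {poly R}) : p != 0 -> polyint w (p ^+ 2) != 0.
Proof.
move=> p0; apply/eqP => int0.
pose f (x : R) := (p ^+ 2).[x] * w x.
have f_ge0 x : 0 <= f x by rewrite mulr_ge0 ?weight_ge0// horner_exp sqr_ge0.
have i_f : mu.-integrable `[0, 1]%classic (EFin \o f) := integrable_horner _ _ integrable_weight.
have [mf _] := integrableP _ _ _ i_f.
have : (\int[mu]_(x in `[0%R, 1%R]) `|(EFin \o f) x| = 0)%E.
  under eq_integral => x _ do rewrite /= ger0_norm//.
  (* The real-valued integral is also 0 when the extended one is infinite; integrability excludes
     that case. *)
  by rewrite -[LHS]fineK ?integrable_fin_num//; congr EFin.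
move/(ae_eq_integral_abs mu (measurable_itv _) mf) => ae0.
have nZ : mu.-negligible [set x : R | root p x]%classic.
  exists [set x : R | root p x]%classic; split => //.
    exact/countable_measurable/finite_set_countable/finite_set_roots.
  exact/countable_lebesgue_measure0/finite_set_countable/finite_set_roots.
have : mu.-negligible (`]0, 1[ : set R)%classic.
  apply: negligibleS (negligibleU ae0 nZ) => x.
  rewrite /= in_itv/= => x01; have [rx|rx] := boolP (root p x); [by right|left].
  have x01' : x \in `[0, 1] by rewrite in_itv/=; lra.
  move=> /(_ x01')[]; apply/eqP; rewrite /f horner_exp mulf_neq0 ?sqrf_eq0//.
  by rewrite gt_eqF// weight_gt0.
move=> /measure_negligible-/(_ (measurable_itv _)); rewrite /= lebesgue_measure_itv/=.
by rewrite lte01 oppr0 adde0 => /eqP; rewrite eqe oner_eq0.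
Qed.
End weight.

(** * Consequences of orthogonality and of the recurrence *)

Section orthogonal_polynomials.
Context {R : realType} {alpha beta t : R}.
Hypotheses (halpha : 0 < alpha) (hbeta : 0 < beta) (ht : 0 <= t).
Context {P : nat -> {poly R}} {h a b : nat -> R}.
Hypothesis hP : monic_orthogonal (weight alpha beta t) P h.
Hypothesis hab : recurrence_coefficients P a b.
Local Notation w := (weight alpha beta t).
Local Notation wx := (fun x => w x / x).
Local Notation wy := (fun x => w x / (1 - x)).

Let iw := integrable_weight halpha hbeta ht.
Let iwx := integrable_weight_div halpha hbeta ht.
Let iwy := integrable_weight_div_onem halpha hbeta ht.

Lemma polyint_ortho m n : polyint w (P m * P n) = if m == n then h n else 0.
Proof.
by rewrite -(hP.2 m n); apply: eq_Rintegral => x _; rewrite hornerM.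
Qed.

(** This is not part of [monic_orthogonal]; it is what makes the divisions by [h n] meaningful. *)
Lemma norm_neq0 n : h n != 0.
Proof.
have <- : polyint w (P n ^+ 2) = h n by rewrite expr2 polyint_ortho eqxx.
apply: (polyint_weight_sqr_neq0 halpha hbeta ht).
by apply: monic_neq0; exact: (hP.1 n).1.
Qed.

Lemma polyint_ortho_lt n (q : {poly R}) : (size q <= n)%N -> polyint w (q * P n) = 0.
Proof.
suff H k (r : {poly R}) : (k <= n)%N -> (size r <= k)%N -> polyint w (r * P n) = 0.
  exact: H.
elim: k r => [|k IH] r kn.
  by rewrite leqn0 size_poly_eq0 => /eqP ->; rewrite mul0r polyint0.
move=> rk; have [/monicP lPk sPk] := hP.1 k.
(* As [P k] is monic of degree [k], subtracting this multiple kills the coefficient of degree [k];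
   the subtracted part is orthogonal to [P n] because [k < n]. *)
rewrite -(subrK (r`_k *: P k) r) mulrDl polyintD// -scalerAl polyintZ//.
rewrite polyint_ortho ltn_eqF// mulr0 addr0; apply: IH; first exact: ltnW.
apply/leq_sizeP => i; rewrite leq_eqVlt => /predU1P[<-|ki].
  by move: lPk; rewrite /lead_coef sPk/= coefB coefZ => ->; rewrite mulr1 subrr.
rewrite coefB coefZ (nth_default _ (leq_trans rk ki)) [(P k)`_i]nth_default ?sPk//.
by rewrite mulr0 subrr.
Qed.

(** The integral of x P_n P_{n+1} w is computed in two ways, applying the recurrence to x P_{n+1} or
    to x P_n. *)
Lemma recurrence_norm n : b n.+1 * h n = h n.+1.
Proof.
have : polyint w (('X * P n.+1) * P n) = polyint w (('X * P n) * P n.+1).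
  by congr (polyint _ _); ring.
rewrite hab [in RHS]hab !mulrDl !polyintD// -!scalerAl !polyintZ//.
rewrite !polyint_ortho !eqxx gtn_eqF// gtn_eqF// ltn_eqF// mulr0 !add0r => ->.
(* What remains is the P_{n-1} term, which is 0 by convention for [n = 0] and by orthogonality
   otherwise. *)
rewrite mulr0 addr0; case: n => [|n]; first by rewrite mul0r polyint0 ?addr0.
by rewrite -scalerAl polyintZ// polyint_ortho ltn_eqF// mulr0 addr0.
Qed.

Lemma polyint_deriv_norm n :
  polyint w (('X * P n ^+ 2)^`()) = (2 * n + 1)%:R * h n.
Proof.
set q := 'X * (P n)^`() - n%:R *: P n.
have sq : (size q <= n)%N.
  apply/leq_sizeP => i ni; rewrite /q coefB coefZ coefXM.
  have [_ sPn] := hP.1 n.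
  case: i ni => [|i]; first by rewrite leqn0 => /eqP->; rewrite mul0r subrr.
  (* In degree [n] the two coefficients cancel; in higher degrees those of [P n] are 0. *)
  rewrite leq_eqVlt => /predU1P[->|ni]; rewrite /= coef_deriv; first by rewrite mulr_natl subrr.
  by rewrite (leq_sizeP _ _ (eq_leq sPn)) ?mul0rn ?mulr0 ?subrr.
have -> : ('X * P n ^+ 2)^`() = (2 * n + 1)%:R *: (P n * P n) + 2%:R *: (q * P n).
  rewrite expr2 !derivM derivX mul1r /q -!mul_polyC !rmorph_nat natrD natrM; ring.
rewrite polyintD// !polyintZ// polyint_ortho eqxx polyint_ortho_lt//.
by rewrite mulr0 addr0.
Qed.

End orthogonal_polynomials.

(** * Assembly of the three identities *)

Theorem proposition2p4 (R : realType) (alpha beta t : R)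
    (halpha : 0 < alpha) (hbeta : 0 < beta) (ht : 0 <= t)
    (P : nat -> {poly R}) (h a b : nat -> R)
    (hP : monic_orthogonal (weight alpha beta t) P h)
    (hab : recurrence_coefficients P a b) :
  let w := weight alpha beta t in
  forall n : nat,
    [/\ aux_rstar t w P h n.+1 + aux_rstar t w P h n
          = t - a n * aux_Rstar t w P h n,
        aux_Rstar t w P h n - aux_R beta w P h n
          = - 2 * n%:R - 1 - alpha - beta &
        aux_r beta w P h n.+1 + aux_r beta w P h n
          = (1 - a n) * aux_R beta w P h n - beta].
Proof.
move=> w n.
pose wx x := w x / x; pose wy x := w x / (1 - x).
have iwx : lebesgue_measure.-integrable `[0, 1]%classic (EFin \o wx).
  exact: integrable_weight_div.
have iwy : lebesgue_measure.-integrable `[0, 1]%classic (EFin \o wy).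
  exact: integrable_weight_div_onem.
have hn k : h k != 0 := norm_neq0 halpha hbeta ht hP k.
have orth k : polyint w (P k ^+ 2) = h k.
  by rewrite expr2 (polyint_ortho hP) eqxx.
have RsE k : aux_Rstar t w P h k = t / h k * polyint wx (P k ^+ 2).
  by congr (_ * _); apply: eq_Rintegral => x _; rewrite horner_exp -mulrA.
have RE k : aux_R beta w P h k = beta / h k * polyint wy (P k ^+ 2).
  by congr (_ * _); apply: eq_Rintegral => x _; rewrite horner_exp -mulrA.
have rsE k : aux_rstar t w P h k.+1 = t * (polyint wx (P k * P k.+1) / h k).
  rewrite [RHS]mulrA [RHS]mulrAC.
  by congr (_ * _); apply: eq_Rintegral => x _; rewrite hornerM -mulrA.
have rE k : aux_r beta w P h k.+1 = beta * (polyint wy (P k * P k.+1) / h k).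
  rewrite [RHS]mulrA [RHS]mulrAC.
  by congr (_ * _); apply: eq_Rintegral => x _; rewrite hornerM -mulrA.
have PS k : P k.+1 = 'X * P k - a k *: P k - (if k is m.+1 then b m.+1 *: P m else 0).
  by rewrite hab [X in X - _ - _]addrAC !addrK.
have wxX : polyint wx ('X * P n ^+ 2) = h n.
  by rewrite (polyint_weight_div halpha) orth.
(* Writing X = 1 - (1 - X), the factor 1 - X cancels the pole at 1. *)
have wyX : polyint wy ('X * P n ^+ 2) = polyint wy (P n ^+ 2) - h n.
  rewrite -(orth n) -(polyint_weight_div_onem hbeta) -polyintB//.
  by congr (polyint _ _); ring.
(* The common form of [aux_rstar] and [aux_r] at [n], without the prefactor [t] or [beta]; the value
   0 at [n = 0] matches r_0 = r_0^* = 0. *)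
pose S g := if n is m.+1 then polyint g (P m * P m.+1) / h m else 0.
(* The recurrence times P_n g, integrated and divided by h_n. Since b_n / h_n = 1 / h_{n-1}, the
   last term becomes [S g]. Taking [wx] and [wy] for [g] gives the first and third identities. *)
have step g : lebesgue_measure.-integrable `[0, 1]%classic (EFin \o g) ->
    polyint g (P n * P n.+1) / h n = (polyint g ('X * P n ^+ 2) - a n * polyint g (P n ^+ 2)) / h n
      - S g.
  move=> ig; rewrite PS !mulrBr -scalerAr !polyintB// polyintZ// mulrCA -expr2.
  rewrite mulrBl; congr (_ - _); rewrite /S; case: (n) => [|m].
    by rewrite mulr0 polyint0// mul0r.
  rewrite -scalerAr polyintZ// -(recurrence_norm halpha hbeta ht hP hab).
  rewrite (mulrC (P m.+1)); field.
  (* Nonvanishing of h_{m+1} = b_{m+1} h_m provides that of both factors, which [field] requires. *)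
  by have := hn m.+1; rewrite -(recurrence_norm halpha hbeta ht hP hab) mulf_eq0 negb_or andbC.
have rsS : aux_rstar t w P h n
    = t * S wx.
  by rewrite /S; case: (n) => [|m]; rewrite ?mulr0// rsE.
have rS : aux_r beta w P h n
    = beta * S wy.
  by rewrite /S; case: (n) => [|m]; rewrite ?mulr0// rE.
split.
- rewrite rsE RsE rsS step// wxX; field.
  exact: hn.
- rewrite RsE RE.
  (* Integration by parts applied to p = P_n^2. *)
  have E : (2 * n%:R + 1) * h n + t * polyint wx (P n ^+ 2) + (alpha + beta) * h n
      - beta * polyint wy (P n ^+ 2) = 0.
    rewrite -(polyint_by_parts halpha hbeta ht (P n ^+ 2)).
    by rewrite (polyint_deriv_norm halpha hbeta ht hP) orth natrD natrM.
  (* After multiplication by [h n], the difference of the two sides is exactly the left-hand side of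
     [E]. *)
  apply: (mulIf (hn n)); apply/eqP; rewrite -subr_eq0 -E; apply/eqP; field.
  exact: hn.
- rewrite rE RE rS step// wyX; field.
  exact: hn.
Qed.
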